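(* Let $\{U^n\}_{n=0}^N$ be a solution of the CNFD scheme. Then for all $n=0,1,\dots,N$, $$E_h(U^n)\le E_h(U^0)+\frac{\lambda^2}{4\nu}\|U^0\|_{2,h}^2.$$
   Context: Constants: $\lambda\in\mathbb{R}$, $\nu>0$, $\varepsilon\ge 0$, $T>0$; $\Omega=(a,b)\times(c,d)\subset\mathbb{R}^2$; $u_0:\overline\Omega\to\mathbb{C}$, vanishing on $\partial\Omega$. Grid: $x_j=a+j\Delta x$, $\Delta x=(b-a)/J$, $y_k=c+k\Delta y$, $\Delta y=(d-c)/K$, for $0\le j\le J$, $0\le k\le K$, with $\Delta x=\Delta y=h$. Time grid: $t_n=n\tau$, $n=0,\dots,N$, $N\tau=T$. $\mathcal{T}_{JK}=\{(j,k):1\le j\le J-1,\ 1\le k\le K-1\}$. $X_{JK}$ is the space of complex grid functions $u=(u_{j,k})_{0\le j\le J,\,0\le k\le K}$ with $u_{0,k}=u_{J,k}=u_{j,0}=u_{j,K}=0$ for all $j,k$. Difference operators: $\delta_t^+u^n_{j,k}=(u^{n+1}_{j,k}-u^n_{j,k})/\tau$, $\delta_x^+u_{j,k}=(u_{j+1,k}-u_{j,k})/\Delta x$, $\delta_y^+u_{j,k}=(u_{j,k+1}-u_{j,k})/\Delta y$, $\delta^2u_{j,k}=\frac{u_{j+1,k}-2u_{j,k}+u_{j-1,k}}{(\Delta x)^2}+\frac{u_{j,k+1}-2u_{j,k}+u_{j,k-1}}{(\Delta y)^2}$. Norms: $\|u\|_{p,h}^p=\Delta x\Delta y\sum_{j=0}^{J-1}\sum_{k=0}^{K-1}|u_{j,k}|^p$,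 $\|\delta^+u\|_{2,h}^2=\|\delta_x^+u\|_{2,h}^2+\|\delta_y^+u\|_{2,h}^2$. Discrete energy: $E_h(U)=\|\delta^+U\|_{2,h}^2-\frac{\lambda}{2}\|U\|_{4,h}^4+\frac{\nu}{3}\|U\|_{6,h}^6$. For $z,w\in\mathbb{C}$: $\psi_1(z,w)=\frac{|z|^2+|w|^2}{2}\cdot\frac{z+w}{2}$, $\psi_2(z,w)=\frac{|z|^4+|z|^2|w|^2+|w|^4}{3}\cdot\frac{z+w}{2}$, $\varphi(z,w)=\left|\frac{z+w}{2}\right|^2\frac{z+w}{2}$. CNFD scheme: $\{U^n\}_{n=0}^N$ is a solution if $U^0_{j,k}=u_0(x_j,y_k)$, $U^{n+1}\in X_{JK}$ for $n=0,\dots,N-1$, and, with $U^{n+1/2}=\frac12(U^{n+1}+U^n)$, for all $(j,k)\in\mathcal{T}_{JK}$ and $n=0,\dots,N-1$, $$i\delta_t^+U^n_{j,k}+\delta^2U^{n+1/2}_{j,k}+\lambda\psi_1(U^{n+1}_{j,k},U^n_{j,k})-\nu\psi_2(U^{n+1}_{j,k},U^n_{j,k})+i\varepsilon\varphi(U^{n+1}_{j,k},U^n_{j,k})=0.$$ *)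

(* Defs.v *)
From mathcomp Require Import all_boot all_order all_algebra.
From mathcomp Require Import all_classical all_reals all_analysis.
From mathcomp Require Export complex.

Set Implicit Arguments.
Unset Strict Implicit.
Unset Printing Implicit Defensive.

Import Order.TTheory GRing.Theory Num.Theory numFieldNormedType.Exports.
Export numFieldNormedType.Exports.

Local Open Scope classical_set_scope.
Local Open Scope ring_scope.
Local Open Scope complex_scope.

(* Real-valued modulus: the norm of R[i] as a numDomainType is R[i]-valued. *)
Notation cabs := ComplexField.Normc.normc.

(* A grid function (u_{j,k}) for 0 <= j <= J, 0 <= k <= K is represented by a
   total function on nat * nat; no definition below that depends on J and K
   reads a value outside this range. *)
Definition gridfun (R : realType) : Type := nat -> nat -> R[i].

Definition rectangle (R : realType) (a b c d : R) : set (R * R) :=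
  [set p | a < p.1 < b /\ c < p.2 < d].

Definition boundary (T : topologicalType) (A : set T) : set T :=
  closure A `\` interior A.

Definition gridpt (R : realType) (x0 dx : R) (j : nat) : R := x0 + j%:R * dx.

(* The index set of interior nodes. *)
Definition interior_index (J K j k : nat) : bool :=
  (1 <= j <= J - 1)%N && (1 <= k <= K - 1)%N.

Definition in_XJK (R : realType) (J K : nat) (u : gridfun R) : Prop :=
  (forall k, (k <= K)%N -> u 0%N k = 0 /\ u J k = 0) /\
  (forall j, (j <= J)%N -> u j 0%N = 0 /\ u j K = 0).

Definition dtp (R : realType) (tau : R) (U : nat -> gridfun R) (n : nat) :
  gridfun R := fun j k => (U n.+1 j k - U n j k) / tau%:C.

Definition dxp (R : realType) (dx : R) (u : gridfun R) : gridfun R :=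
  fun j k => (u j.+1 k - u j k) / dx%:C.

Definition dyp (R : realType) (dy : R) (u : gridfun R) : gridfun R :=
  fun j k => (u j k.+1 - u j k) / dy%:C.

(* Only meaningful for 1 <= j and 1 <= k, since 0.-1 = 0. *)
Definition d2 (R : realType) (dx dy : R) (u : gridfun R) : gridfun R :=
  fun j k =>
    (u j.+1 k - 2 * u j k + u j.-1 k) / (dx ^+ 2)%:C +
    (u j k.+1 - 2 * u j k + u j k.-1) / (dy ^+ 2)%:C.

(* The p-th power ||u||_{p,h}^p of the discrete L^p norm. *)
Definition normhX (R : realType) (J K : nat) (dx dy : R) (p : nat)
    (u : gridfun R) : R :=
  dx * dy * \sum_(0 <= j < J) \sum_(0 <= k < K) cabs (u j k) ^+ p.

(* The square ||delta^+ u||_{2,h}^2 of the discrete gradient norm. *)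
Definition grad_normh2 (R : realType) (J K : nat) (dx dy : R)
    (u : gridfun R) : R :=
  normhX J K dx dy 2 (dxp dx u) + normhX J K dx dy 2 (dyp dy u).

Definition energyh (R : realType) (J K : nat) (dx dy lambda nu : R)
    (u : gridfun R) : R :=
  grad_normh2 J K dx dy u - lambda / 2 * normhX J K dx dy 4 u
  + nu / 3 * normhX J K dx dy 6 u.

Definition psi1 (R : realType) (z w : R[i]) : R[i] :=
  ((cabs z ^+ 2 + cabs w ^+ 2) / 2)%:C * ((z + w) / 2).

Definition psi2 (R : realType) (z w : R[i]) : R[i] :=
  ((cabs z ^+ 4 + cabs z ^+ 2 * cabs w ^+ 2 + cabs w ^+ 4) / 3)%:C
  * ((z + w) / 2).

Definition phi (R : realType) (z w : R[i]) : R[i] :=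
  (cabs ((z + w) / 2) ^+ 2)%:C * ((z + w) / 2).

Definition half_step (R : realType) (U : nat -> gridfun R) (n : nat) :
  gridfun R := fun j k => 2^-1 * (U n.+1 j k + U n j k).

Definition cnfd_solution (R : realType) (a c : R) (J K N : nat)
    (dx dy tau lambda nu eps : R) (u0 : R * R -> R[i])
    (U : nat -> gridfun R) : Prop :=
  [/\ forall j k, (j <= J)%N -> (k <= K)%N ->
        U 0%N j k = u0 (gridpt a dx j, gridpt c dy k),
      forall n, (n < N)%N -> in_XJK J K (U n.+1)
    & forall n j k, (n < N)%N -> interior_index J K j k ->
        'i%C * dtp tau U n j k + d2 dx dy (half_step U n) j k
        + lambda%:C * psi1 (U n.+1 j k) (U n j k)
        - nu%:C * psi2 (U n.+1 j k) (U n j k)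
        + 'i%C * eps%:C * phi (U n.+1 j k) (U n j k) = 0].

(* Main.v *)
Require Import Defs.
From mathcomp Require Import all_boot all_order all_algebra.
From mathcomp Require Import all_classical all_reals all_analysis.
From mathcomp Require Import ring lra.

Import Order.TTheory GRing.Theory Num.Theory.

Local Open Scope classical_set_scope.
Local Open Scope ring_scope.
Local Open Scope complex_scope.

(** Write [z] and [w] for the new and the old time level, [m = (z + w) / 2],
[L = delta^2 m], and [c = lambda A - nu B] for the real factor such that the
cubic and quintic terms of the scheme are [c m].  At each node the scheme reads
[i (z - w) / tau + L + c m + i eps |m|^2 m = 0].

Testing it with [m] and taking imaginary parts gives the mass law
[||z||_2^2 - ||w||_2^2 = - 2 tau eps ||m||_4^4].
Testing it with [z - w] and taking real parts gives the energy, because [psi1]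
and [psi2] are discrete gradients of the quartic and sextic potentials; the
damping term leaves [Im (m conj (z - w))], which the scheme itself expresses
through [L] and [c].  The outcome is
[E(z) - E(w) = 2 eps tau (sum Re (L conj (|m|^2 m)) + sum c |m|^4)].

The first sum is nonpositive: summation by parts turns it into minus a pairing
of the gradients of [m] and [|m|^2 m], and [p |-> |p|^2 p] is a monotone map
([cdot_monotone_cubic]).  For the second sum, completing the square gives
[c <= lambda^2 / (4 nu)] ([slope_le]).  The mass law then converts
[2 eps tau ||m||_4^4] into the loss of mass, so that
[E + lambda^2 / (4 nu) ||.||_2^2] does not increase in one step ([cnfd_step]).
Iterating and dropping the nonnegative final mass gives the claim.  The
boundary condition on [u0] puts [U^0] in the space of grid functions vanishing
on the boundary, as the summation by parts in the first step needs. *)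

(** * The real inner product of the complex plane *)

(** This is [Re (u conj v)]: a real bilinear form, so that real and imaginary
parts of tested equations are handled without conjugates. *)
Definition cdot {R : realType} (u v : R[i]) : R :=
  complex.Re u * complex.Re v + complex.Im u * complex.Im v.

Lemma cdotC {R : realType} (u v : R[i]) : cdot u v = cdot v u.
Proof. by rewrite /cdot mulrC [complex.Im u * _]mulrC. Qed.

Lemma cdotDl {R : realType} (u v w : R[i]) :
  cdot (u + v) w = cdot u w + cdot v w.
Proof. by case: u v w => ? ? [? ?] [? ?]; rewrite /cdot /=; ring. Qed.

Lemma cdotNl {R : realType} (u v : R[i]) : cdot (- u) v = - cdot u v.
Proof. by case: u v => ? ? [? ?]; rewrite /cdot /=; ring. Qed.

Lemma cdotBl {R : realType} (u v w : R[i]) :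
  cdot (u - v) w = cdot u w - cdot v w.
Proof. by rewrite cdotDl cdotNl. Qed.

Lemma cdotBr {R : realType} (u v w : R[i]) :
  cdot w (u - v) = cdot w u - cdot w v.
Proof. by rewrite cdotC cdotBl !(cdotC w). Qed.

Lemma cdotZl {R : realType} (t : R) (u v : R[i]) :
  cdot (t%:C * u) v = t * cdot u v.
Proof. by case: u v => ? ? [? ?]; rewrite /cdot /=; ring. Qed.

Lemma cdotZr {R : realType} (t : R) (u v : R[i]) :
  cdot u (t%:C * v) = t * cdot u v.
Proof. by rewrite cdotC cdotZl cdotC. Qed.

Lemma cdotr0 {R : realType} (u : R[i]) : cdot u 0 = 0.
Proof. by rewrite /cdot /= !mulr0 addr0. Qed.

Lemma cdot_ge0 {R : realType} (u : R[i]) : 0 <= cdot u u.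
Proof. by rewrite /cdot -!expr2 addr_ge0 ?sqr_ge0. Qed.

Lemma cabs_sqr {R : realType} (u : R[i]) : cabs u ^+ 2 = cdot u u.
Proof. by case: u => x y; rewrite /= sqr_sqrtr ?addr_ge0 ?sqr_ge0. Qed.

Lemma cabs_exp4 {R : realType} (u : R[i]) : cabs u ^+ 4 = cdot u u ^+ 2.
Proof. by rewrite -cabs_sqr -exprM. Qed.

Lemma cabs_exp6 {R : realType} (u : R[i]) : cabs u ^+ 6 = cdot u u ^+ 3.
Proof. by rewrite -cabs_sqr -exprM. Qed.

Lemma divc_real {R : realType} (u : R[i]) (t : R) :
  u / t%:C = (t^-1)%:C * u.
Proof. by rewrite mulrC fmorphV. Qed.

Lemma halfc {R : realType} : 2^-1 = (2^-1)%:C :> R[i].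
Proof. by rewrite fmorphV rmorph_nat. Qed.

(** The map [p |-> |p|^2 p] is the gradient of the convex function [|p|^4 / 4];
the explicit form of the pairing is
[((|p|^2 - |q|^2)^2 + (|p|^2 + |q|^2) |p - q|^2) / 2]. *)
Lemma cdot_monotone_cubic {R : realType} (p q : R[i]) :
  0 <= cdot (p - q) ((cdot p p)%:C * p - (cdot q q)%:C * q).
Proof.
have -> : cdot (p - q) ((cdot p p)%:C * p - (cdot q q)%:C * q) =
   ((cdot p p - cdot q q) ^+ 2
     + (cdot p p + cdot q q) * cdot (p - q) (p - q)) / 2.
  by rewrite !cdotBl !cdotBr !cdotZr (cdotC q p); field.
apply: divr_ge0 => //; apply: addr_ge0; first exact: sqr_ge0.
by apply: mulr_ge0; [apply: addr_ge0; exact: cdot_ge0 | exact: cdot_ge0].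
Qed.

(** * Pointwise consequences of the scheme *)

(** The real number [c] with [lambda psi1 - nu psi2 = c (z + w) / 2]. *)
Definition slope {R : realType} (lambda nu : R) (z w : R[i]) : R :=
  lambda * ((cdot z z + cdot w w) / 2)
  - nu * ((cdot z z ^+ 2 + cdot z z * cdot w w + cdot w w ^+ 2) / 3).

(** With [s = |z|^2] and [t = |w|^2], the quintic factor
[(s^2 + s t + t^2) / 3] exceeds the square of the cubic factor [(s + t) / 2]
by [(s - t)^2 / 12]; completing the square in [(s + t) / 2] does the rest. *)
Lemma slope_le {R : realType} (lambda nu : R) (z w : R[i]) :
  0 < nu -> slope lambda nu z w <= lambda ^+ 2 / (4 * nu).
Proof.
move=> nu0; rewrite -subr_ge0.
set s := cdot z z; set t := cdot w w.
have -> : lambda ^+ 2 / (4 * nu) - slope lambda nu z w =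
   (lambda - nu * (s + t)) ^+ 2 / (4 * nu) + nu * (s - t) ^+ 2 / 12.
  by rewrite /slope -/s -/t; field; rewrite gt_eqF.
apply: addr_ge0; apply: divr_ge0 => //; first exact: sqr_ge0.
  by apply: mulr_ge0 => //; exact: ltW.
by apply: mulr_ge0; [exact: ltW | exact: sqr_ge0].
Qed.

Definition mid {R : realType} (z w : R[i]) : R[i] := 2^-1 * (z + w).

Lemma cdot_mid_sub {R : realType} (z w : R[i]) :
  cdot (mid z w) (z - w) = (cdot z z - cdot w w) / 2.
Proof. by rewrite /mid halfc cdotZl !cdotDl !cdotBr (cdotC w z); field. Qed.

(** Rotation by a right angle: this is why the Laplacian drops out of the mass
law. *)
Lemma cdotNi {R : realType} (z : R[i]) : cdot z (- 'i%C * z) = 0.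
Proof. by case: z => x y; rewrite /cdot /=; ring. Qed.

(** The discrete chain rule that makes the scheme conserve energy when there is
no damping: [psi1] and [psi2] are difference quotients of the potentials. *)
Lemma slope_diff {R : realType} (lambda nu : R) (z w : R[i]) :
  slope lambda nu z w * ((cdot z z - cdot w w) / 2)
  = lambda / 4 * (cdot z z ^+ 2 - cdot w w ^+ 2)
    - nu / 6 * (cdot z z ^+ 3 - cdot w w ^+ 3).
Proof. by rewrite /slope; field. Qed.

(** The two tested equations at one node, with the Laplacian [L] kept abstract.
The first is the product with [m], imaginary part.  The second is the product
with [z - w], real part, where the term [Im (m conj (z - w))] coming from the
damping has been eliminated by the scheme. *)
Lemma node_identities {R : realType} (lambda nu eps tau : R) (z w L : R[i]) :
  tau != 0 ->
  'i%C * ((z - w) / tau%:C) + L + lambda%:C * psi1 z w - nu%:C * psi2 z w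
    + 'i%C * eps%:C * phi z w = 0 ->
  let m := mid z w in
  let c := slope lambda nu z w in
  (cdot z z - cdot w w) / 2
    = tau * cdot L (- 'i%C * m) - tau * eps * cdot m m ^+ 2 /\
  cdot L (z - w) + c * ((cdot z z - cdot w w) / 2)
    + eps * tau * (cdot L ((cdot m m)%:C * m) + c * cdot m m ^+ 2) = 0.
Proof.
move=> tau0 + m c; rewrite /psi1 /psi2 /phi !cabs_exp4 !cabs_sqr.
have -> : (z + w) / 2 = m by rewrite /m /mid mulrC.
rewrite divc_real => E.
have {}E : 'i%C * ((tau^-1)%:C * (z - w)) + L + c%:C * m
    + 'i%C * (eps * cdot m m)%:C * m = 0.
  rewrite -[RHS]E /c /slope.
  set A := (_ + _) / 2; set B := (_ + _) / 3; rewrite rmorphB !rmorphM /=.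
  ring.
rewrite -cdot_mid_sub -/m cdotZr.
clearbody c m; move: (z - w) E => D E.
have [q q0] : exists q, q = cdot m m by exists (cdot m m).
move: E; rewrite -!q0; move: q0; rewrite /cdot.
case: m D L => mx my [Dx Dy] [Lx Ly] /= q0 E.
(* The real part of the scheme determines the imaginary part of z - w, and
   conversely. *)
have /= E1 := congr1 (@complex.Re R) E; have /= E2 := congr1 (@complex.Im R) E.
have Dy_eq : Dy = tau * (Lx + c * mx - eps * q * my).
  apply: (mulfI (invr_neq0 tau0)); rewrite mulKf //. lra.
have Dx_eq : Dx = - tau * (Ly + c * my + eps * q * mx).
  apply: (mulfI (invr_neq0 tau0)); rewrite mulNr mulrN mulKf //. lra.
rewrite /cdot /= Dy_eq Dx_eq q0; split; ring.
Qed.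

(** * Sums over the grid *)

Definition gsum {R : realType} (J K : nat) (F : nat -> nat -> R) : R :=
  \sum_(0 <= j < J) \sum_(0 <= k < K) F j k.

Lemma gsum_eq {R : realType} (J K : nat) (F G : nat -> nat -> R) :
  (forall j k, (j < J)%N -> (k < K)%N -> F j k = G j k) ->
  gsum J K F = gsum J K G.
Proof.
move=> FG; apply: eq_big_nat => j /andP[_ jJ].
by apply: eq_big_nat => k /andP[_ kK]; exact: FG.
Qed.

Lemma gsumD {R : realType} (J K : nat) (F G : nat -> nat -> R) :
  gsum J K (fun j k => F j k + G j k) = gsum J K F + gsum J K G.
Proof. by rewrite /gsum -big_split; apply: eq_bigr => j _; exact: big_split. Qed.

Lemma gsumZ {R : realType} (J K : nat) (t : R) (F : nat -> nat -> R) :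
  gsum J K (fun j k => t * F j k) = t * gsum J K F.
Proof. by rewrite /gsum big_distrr; apply: eq_bigr => j _; rewrite big_distrr. Qed.

Lemma gsumB {R : realType} (J K : nat) (F G : nat -> nat -> R) :
  gsum J K (fun j k => F j k - G j k) = gsum J K F - gsum J K G.
Proof.
rewrite -[- gsum _ _ G]mulN1r -gsumZ -gsumD.
by apply: gsum_eq => j k _ _; rewrite mulN1r.
Qed.

Lemma gsum0 {R : realType} (J K : nat) (F : nat -> nat -> R) :
  (forall j k, (j < J)%N -> (k < K)%N -> F j k = 0) -> gsum J K F = 0.
Proof.
move=> F0; rewrite (gsum_eq _ _ _ _ F0).
by apply: big1_seq => j _; exact: big1_seq.
Qed.

Lemma gsum_le {R : realType} (J K : nat) (F G : nat -> nat -> R) :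
  (forall j k, F j k <= G j k) -> gsum J K F <= gsum J K G.
Proof. by move=> FG; apply: ler_sum => j _; apply: ler_sum. Qed.

Lemma gsum_ge0 {R : realType} (J K : nat) (F : nat -> nat -> R) :
  (forall j k, 0 <= F j k) -> 0 <= gsum J K F.
Proof. by move=> F0; apply: sumr_ge0 => j _; apply: sumr_ge0. Qed.

(** * Summation by parts *)

Definition gdot {R : realType} (J K : nat) (f g : gridfun R) : R :=
  gsum J K (fun j k => cdot (f j k) (g j k)).

Definition graddot {R : realType} (J K : nat) (dx dy : R) (f g : gridfun R) : R :=
  gdot J K (dxp dx f) (dxp dx g) + gdot J K (dyp dy f) (dyp dy g).

(** The convention [0.-1 = 0] makes the second difference at [j = 0] equal to
the first forward difference, so the only boundary term of the telescoping sum
is the one at [n]. *)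
Lemma sum_by_parts {R : realType} (n : nat) (f g : nat -> R[i]) :
  g n = 0 ->
  \sum_(0 <= j < n) cdot (f j.+1 - 2 * f j + f j.-1) (g j)
  = - \sum_(0 <= j < n) cdot (f j.+1 - f j) (g j.+1 - g j).
Proof.
move=> gn0; apply/eqP; rewrite -addr_eq0 -big_split /=; apply/eqP.
(* For general g the sum of both sides is the boundary term at n, which is what
   the induction proves. *)
rewrite -[RHS](cdotr0 (f n - f n.-1)) -gn0 {gn0}.
elim: n => [|n IHn]; first by rewrite big_geq // subrr cdotC cdotr0.
rewrite big_nat_recr //= IHn.
rewrite mulr_natl mulr2n !(cdotBl, cdotDl, cdotNl, cdotBr); ring.
Qed.

Lemma discrete_green {R : realType} (J K : nat) (dx dy : R) (f g : gridfun R) :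
  in_XJK J K g -> gdot J K (d2 dx dy f) g = - graddot J K dx dy f g.
Proof.
move=> [gx gy]; rewrite /graddot opprD.
rewrite (_ : gdot J K (d2 dx dy f) g =
  (dx ^+ 2)^-1 * gsum J K (fun j k =>
     cdot (f j.+1 k - 2 * f j k + f j.-1 k) (g j k)) +
  (dy ^+ 2)^-1 * gsum J K (fun j k =>
     cdot (f j k.+1 - 2 * f j k + f j k.-1) (g j k))); last first.
  rewrite -!gsumZ -gsumD; apply: gsum_eq => j k _ _.
  by rewrite /d2 !divc_real [LHS]cdotDl !cdotZl.
have scale (t : R) (u v : R[i]) :
    cdot (u / t%:C) (v / t%:C) = (t ^+ 2)^-1 * cdot u v.
  by rewrite !divc_real cdotZl cdotZr mulrA -expr2 exprVn.
have -> : gdot J K (dxp dx f) (dxp dx g) = (dx ^+ 2)^-1 * gsum J K (fun j k =>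
    cdot (f j.+1 k - f j k) (g j.+1 k - g j k)).
  by rewrite -gsumZ; apply: gsum_eq => j k _ _; exact: scale.
have -> : gdot J K (dyp dy f) (dyp dy g) = (dy ^+ 2)^-1 * gsum J K (fun j k =>
    cdot (f j k.+1 - f j k) (g j k.+1 - g j k)).
  by rewrite -gsumZ; apply: gsum_eq => j k _ _; exact: scale.
rewrite -!mulrN; congr (_ * _ + _ * _).
- rewrite /gsum exchange_big_nat [in RHS]exchange_big_nat -sumrN.
  apply: eq_big_nat => k /andP[_ kK].
  by apply: (sum_by_parts J (f^~ k) (g^~ k)); case: (gx k (ltnW kK)).
- rewrite /gsum -sumrN; apply: eq_big_nat => j /andP[_ jJ].
  by apply: (sum_by_parts K (f j) (g j)); case: (gy j (ltnW jJ)).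
Qed.

(** * Norms and gradient pairings *)

Lemma normhX2E {R : realType} (J K : nat) (dx dy : R) (u : gridfun R) :
  normhX J K dx dy 2 u = dx * dy * gdot J K u u.
Proof. by congr (_ * _); apply: gsum_eq => j k _ _; exact: cabs_sqr. Qed.

Lemma energyhE {R : realType} (J K : nat) (dx dy lambda nu : R) (u : gridfun R) :
  energyh J K dx dy lambda nu u
  = dx * dy * (graddot J K dx dy u u
      - lambda / 2 * gsum J K (fun j k => cdot (u j k) (u j k) ^+ 2)
      + nu / 3 * gsum J K (fun j k => cdot (u j k) (u j k) ^+ 3)).
Proof.
rewrite /energyh /grad_normh2 !normhX2E /normhX -/(graddot J K dx dy u u).
rewrite -!/(gsum J K (fun j k => cabs (u j k) ^+ _)).
rewrite (@gsum_eq _ _ _ (fun j k => cabs (u j k) ^+ 4)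
          (fun j k => cdot (u j k) (u j k) ^+ 2)); last first.
  by move=> j k _ _; exact: cabs_exp4.
rewrite (@gsum_eq _ _ _ (fun j k => cabs (u j k) ^+ 6)
          (fun j k => cdot (u j k) (u j k) ^+ 3)); last first.
  by move=> j k _ _; exact: cabs_exp6.
by rewrite /graddot; ring.
Qed.

Definition gmid {R : realType} (z w : gridfun R) : gridfun R :=
  fun j k => mid (z j k) (w j k).

Lemma graddot_mid_sub {R : realType} (J K : nat) (dx dy : R) (z w : gridfun R) :
  graddot J K dx dy (gmid z w) (fun j k => z j k - w j k)
  = (graddot J K dx dy z z - graddot J K dx dy w w) / 2.
Proof.
rewrite /graddot opprD addrACA mulrDl /gdot -!gsumB mulrC -gsumZ mulrC -gsumZ.
by congr (_ + _); apply: gsum_eq => j k _ _; rewrite [RHS]mulrC -cdot_mid_sub;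
  congr cdot; rewrite /dxp /dyp /gmid /mid; ring.
Qed.

Lemma graddotNi {R : realType} (J K : nat) (dx dy : R) (u : gridfun R) :
  graddot J K dx dy u (fun j k => - 'i%C * u j k) = 0.
Proof.
rewrite /graddot /gdot !gsum0 ?addr0 // => j k _ _.
  rewrite -[RHS](cdotNi (dyp dy u j k)); congr cdot; rewrite /dyp; ring.
rewrite -[RHS](cdotNi (dxp dx u j k)); congr cdot; rewrite /dxp; ring.
Qed.

(** The cubic damping dissipates the gradient energy, by monotonicity applied to
each pair of neighbouring nodes. *)
Lemma graddot_cubic_ge0 {R : realType} (J K : nat) (dx dy : R) (u : gridfun R) :
  0 <= graddot J K dx dy u (fun j k => (cdot (u j k) (u j k))%:C * u j k).
Proof.
have step (t : R) (p q : R[i]) : 0 <= cdot ((p - q) / t%:C)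
   (((cdot p p)%:C * p - (cdot q q)%:C * q) / t%:C).
  rewrite !divc_real cdotZl cdotZr mulrA -expr2.
  by apply: mulr_ge0; [exact: sqr_ge0 | exact: cdot_monotone_cubic].
by apply: addr_ge0; apply: gsum_ge0 => j k; exact: step.
Qed.

(** * Decay in one time step *)

Lemma in_XJK_map2 {R : realType} {J K : nat} {z w : gridfun R}
    (F : R[i] -> R[i] -> R[i]) : F 0 0 = 0 ->
  in_XJK J K z -> in_XJK J K w -> in_XJK J K (fun j k => F (z j k) (w j k)).
Proof.
move=> F0 [zx zy] [wx wy]; split=> [k kK|j jJ].
  by have [-> ->] := zx _ kK; have [-> ->] := wx _ kK.
by have [-> ->] := zy _ jJ; have [-> ->] := wy _ jJ.
Qed.

Lemma in_XJK_node {R : realType} {J K j k : nat} {u : gridfun R} :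
  in_XJK J K u -> (j < J)%N -> (k < K)%N -> ~~ interior_index J K j k ->
  u j k = 0.
Proof.
move=> [ux uy] jJ kK; rewrite /interior_index !subn1.
case: j jJ => [|j] jJ; first by case: (ux k (ltnW kK)).
case: k kK => [|k] kK; first by case: (uy j.+1 (ltnW jJ)).
by rewrite /= -ltnS (ltn_predK jJ) jJ -ltnS (ltn_predK kK) kK.
Qed.

(** The increase of energy allowed by the damping is at most
[lambda^2 / (4 nu)] times the mass that the same damping removes. *)
Lemma cnfd_step {R : realType} {J K : nat} {dx dy tau lambda nu eps : R}
    {z w : gridfun R} :
  0 < dx -> 0 < dy -> 0 < tau -> 0 < nu -> 0 <= eps ->
  in_XJK J K z -> in_XJK J K w ->
  (forall j k, interior_index J K j k ->
     'i%C * ((z j k - w j k) / tau%:C) + d2 dx dy (gmid z w) j k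
     + lambda%:C * psi1 (z j k) (w j k) - nu%:C * psi2 (z j k) (w j k)
     + 'i%C * eps%:C * phi (z j k) (w j k) = 0) ->
  energyh J K dx dy lambda nu z
    + lambda ^+ 2 / (4 * nu) * normhX J K dx dy 2 z
  <= energyh J K dx dy lambda nu w
    + lambda ^+ 2 / (4 * nu) * normhX J K dx dy 2 w.
Proof.
move=> dx0 dy0 tau0 nu0 eps0 zX wX scheme.
set kappa := lambda ^+ 2 / (4 * nu).
pose m := gmid z w; pose L := d2 dx dy m.
pose c j k := slope lambda nu (z j k) (w j k).
pose m4 j k := cdot (m j k) (m j k) ^+ 2.
pose sq (u : gridfun R) j k := cdot (u j k) (u j k).
have mid00 : mid (0 : R[i]) 0 = 0 by rewrite /mid addr0 mulr0.
have node j k : (j < J)%N -> (k < K)%N ->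
    (sq z j k - sq w j k) / 2
      = tau * cdot (L j k) (- 'i%C * m j k) - tau * eps * m4 j k /\
    cdot (L j k) (z j k - w j k) + c j k * ((sq z j k - sq w j k) / 2)
      + eps * tau * (cdot (L j k) ((sq m j k)%:C * m j k)
                     + c j k * m4 j k) = 0.
  move=> jJ kK; have [int|ext] := boolP (interior_index J K j k).
    by apply: node_identities (scheme j k int); rewrite gt_eqF.
  (* On the sides j = 0 and k = 0, which the sums include but the scheme does
     not, z and w vanish and L is multiplied by zero. *)
  have z0 := in_XJK_node zX jJ kK ext; have w0 := in_XJK_node wX jJ kK ext.
  rewrite /m4 /sq /m /gmid z0 w0 mid00 !mulr0 !subrr !cdotr0.
  by rewrite expr0n /=; split; ring.
have mass : (gsum J K (sq z) - gsum J K (sq w)) / 2 = - (tau * eps * gsum J K m4).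
  rewrite -gsumB [LHS]mulrC -[LHS]gsumZ.
  transitivity (tau * gdot J K L (fun j k => - 'i%C * m j k)
                - tau * eps * gsum J K m4).
    rewrite /gdot -!gsumZ -gsumB; apply: gsum_eq => j k jJ kK.
    by rewrite mulrC; case: (node j k jJ kK).
  rewrite discrete_green; last first.
    apply: (in_XJK_map2 (fun a b => - 'i%C * mid a b)) => //.
    by rewrite mid00 mulr0.
  by rewrite graddotNi oppr0 mulr0 sub0r.
have balance :
    gdot J K L (fun j k => z j k - w j k)
    + (lambda / 4 * (gsum J K (fun j k => sq z j k ^+ 2)
                     - gsum J K (fun j k => sq w j k ^+ 2))
       - nu / 6 * (gsum J K (fun j k => sq z j k ^+ 3)
                   - gsum J K (fun j k => sq w j k ^+ 3)))
    + eps * tau * (gdot J K L (fun j k => (sq m j k)%:C * m j k)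
                   + gsum J K (fun j k => c j k * m4 j k)) = 0.
  rewrite -!gsumB -!gsumZ -gsumB /gdot -!gsumD -gsumZ -gsumD.
  apply: gsum0 => j k jJ kK; case: (node j k jJ kK) => _ <-.
  by rewrite /c /sq slope_diff.
have green_diff : gdot J K L (fun j k => z j k - w j k) =
    - ((graddot J K dx dy z z - graddot J K dx dy w w) / 2).
  rewrite discrete_green ?graddot_mid_sub //.
  by apply: (in_XJK_map2 (fun a b => a - b)) => //; exact: subrr.
have green_cubic : gdot J K L (fun j k => (sq m j k)%:C * m j k) <= 0.
  rewrite discrete_green ?oppr_le0 ?graddot_cubic_ge0 //.
  apply: (in_XJK_map2
    (fun a b => (cdot (mid a b) (mid a b))%:C * mid a b)) => //.
  by rewrite mid00 mulr0.
have potential : gsum J K (fun j k => c j k * m4 j k) <= kappa * gsum J K m4.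
  rewrite -gsumZ; apply: gsum_le => j k.
  by apply: ler_wpM2r; [exact: sqr_ge0 | exact: slope_le].
rewrite !energyhE !normhX2E /gdot -!/(sq _).
rewrite ![kappa * _]mulrCA -!mulrDr; apply: ler_wpM2l.
  by apply: mulr_ge0; exact: ltW.
(* The rest is a linear combination of the energy balance, the bound on the
   damping terms and kappa times the mass law. *)
have := ler_wpM2l (mulr_ge0 eps0 (ltW tau0)) (lerD green_cubic potential).
move: balance; rewrite green_diff => balance bound.
have mass' := congr1 ( *%R kappa) mass.
move: bound mass' balance; rewrite /sq; lra.
Qed.

(** * The initial grid function vanishes on the boundary *)

Lemma in_boundary_rectangle {R : realType} (a b c d x y : R) :
  a < b -> c < d -> a <= x <= b -> c <= y <= d ->
  [\/ x = a, x = b, y = c | y = d] -> boundary (rectangle a b c d) (x, y).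
Proof.
move=> ab cd /andP[ax xb] /andP[cy yd] side; split; last first.
  move=> /interior_subset[/= /andP[ax' xb'] /andP[cy' yd']].
  by case: side => e; move: ax' xb' cy' yd'; rewrite e ?ltxx.
(* The segment towards the centre of the rectangle approaches the side, or the
   corner, through interior points. *)
pose f (t : R) := (x + t * ((a + b) / 2 - x), y + t * ((c + d) / 2 - y)).
have f_cvg : f t @[t --> 0^'+] --> (x, y).
  have line (p q : R) : p + t * q @[t --> 0^'+] --> p.
    rewrite -[X in _ --> X]addr0 -{2}(mul0r q).
    apply: cvgD; first exact: cvg_cst.
    apply: cvgMl; exact: cvg_at_right_filter.
  exact: cvg_pair (line _ _) (line _ _).
move=> B /f_cvg fB.
have [t [[t0 t1] Bt]] : exists t : R, (0 < t /\ t < 1) /\ B (f t).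
  apply: (@filter_ex _ (0^'+)).
  near=> t; split; last by near: t.
  by split; near: t; [exact: nbhs_right_gt | exact: nbhs_right_lt].
by exists (f t); split => //; split; apply/andP; split; rewrite /=; nra.
Unshelve. all: end_near.
Qed.

Lemma gridpt0 {R : realType} (x0 dx : R) : gridpt x0 dx 0 = x0.
Proof. by rewrite /gridpt mul0r addr0. Qed.

Lemma gridpt_last {R : realType} (n : nat) (p q : R) :
  (0 < n)%N -> gridpt p ((q - p) / n%:R) n = q.
Proof.
by move=> n0; rewrite /gridpt mulrC divfK ?subrKC // pnatr_eq0 -lt0n.
Qed.

Lemma gridpt_itv {R : realType} {n j : nat} {p q : R} :
  p < q -> (0 < n)%N -> (j <= n)%N -> p <= gridpt p ((q - p) / n%:R) j <= q.
Proof.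
move=> pq n0 jn; have dp0 : 0 <= (q - p) / n%:R.
  by rewrite divr_ge0 ?ler0n // subr_ge0 ltW.
rewrite -{3}(@gridpt_last _ n p q n0) /gridpt lerDl mulr_ge0 ?ler0n //=.
by rewrite lerD2l ler_wpM2r // ler_nat.
Qed.

Theorem lemma3p5 (R : realType) (lambda nu eps T a b c d : R)
    (u0 : R * R -> R[i]) (J K N : nat) (dx dy h tau : R)
    (U : nat -> gridfun R)
    (nu_gt0 : 0 < nu) (eps_ge0 : 0 <= eps) (T_gt0 : 0 < T)
    (ltab : a < b) (ltcd : c < d)
    (u0_bnd : forall p, boundary (rectangle a b c d) p -> u0 p = 0)
    (J_gt0 : (0 < J)%N) (K_gt0 : (0 < K)%N)
    (dxE : dx = (b - a) / J%:R) (dyE : dy = (d - c) / K%:R)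
    (dxh : dx = h) (dyh : dy = h)
    (NtauE : N%:R * tau = T)
    (solU : cnfd_solution a c J K N dx dy tau lambda nu eps u0 U) :
  forall n : nat, (n <= N)%N ->
    energyh J K dx dy lambda nu (U n)
    <= energyh J K dx dy lambda nu (U 0%N)
       + lambda ^+ 2 / (4 * nu) * normhX J K dx dy 2 (U 0%N).
Proof.
case: solU => U0E UX scheme.
have tau0 : 0 < tau.
  rewrite ltNge; apply/negP => tau_le0; move: T_gt0.
  by rewrite -NtauE ltNge mulr_ge0_le0 ?ler0n.
have dx0 : 0 < dx by rewrite dxE divr_gt0 ?subr_gt0 ?ltr0n.
have dy0 : 0 < dy by rewrite dyE divr_gt0 ?subr_gt0 ?ltr0n.
have U0X : in_XJK J K (U 0%N).
  split=> [k kK|j jJ]; rewrite !U0E // dxE dyE ?gridpt0 ?gridpt_last //.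
    have y_itv := gridpt_itv ltcd K_gt0 kK.
    split; apply: u0_bnd; apply: in_boundary_rectangle => //.
    - by rewrite lexx ltW.
    - exact: Or41.
    - by rewrite lexx ltW.
    - exact: Or42.
  have x_itv := gridpt_itv ltab J_gt0 jJ.
  split; apply: u0_bnd; apply: in_boundary_rectangle => //.
  - by rewrite lexx ltW.
  - exact: Or43.
  - by rewrite lexx ltW.
  - exact: Or44.
have inX n : (n <= N)%N -> in_XJK J K (U n) by case: n => [|n] // /UX.
have decay n : (n <= N)%N ->
    energyh J K dx dy lambda nu (U n)
      + lambda ^+ 2 / (4 * nu) * normhX J K dx dy 2 (U n)
    <= energyh J K dx dy lambda nu (U 0%N)
      + lambda ^+ 2 / (4 * nu) * normhX J K dx dy 2 (U 0%N).
  elim: n => [|n IHn] nN; first exact: lexx.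
  apply: le_trans (IHn (ltnW nN)).
  apply: (cnfd_step dx0 dy0 tau0 nu_gt0 eps_ge0 (inX _ nN) (inX _ (ltnW nN))).
  by move=> j k; exact: (scheme n j k nN).
move=> n nN; apply: le_trans (decay n nN); rewrite lerDl.
apply: mulr_ge0.
  by apply: divr_ge0; [exact: sqr_ge0 | apply: mulr_ge0 => //; exact: ltW].
rewrite normhX2E; apply: mulr_ge0; first by apply: mulr_ge0; exact: ltW.
by apply: gsum_ge0 => j k; exact: cdot_ge0.
Qed.
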